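(* For every $\alpha\in(0,1)$ and every integer $r\ge 1$ the limit $$e_{\alpha,r}=\lim_{n\to\infty}\sqrt[n]{|B_{n,\alpha,r}|}$$ exists. Moreover $e_{\alpha,r}$ is continuous in $\alpha$ uniformly with respect to $r$: for every $\alpha\in(0,1)$ and every $\varepsilon>0$ there is $\delta>0$ such that for all $\alpha'\in(0,1)$ with $|\alpha'-\alpha|<\delta$ and all integers $r\ge 1$ one has $|e_{\alpha',r}-e_{\alpha,r}|<\varepsilon$.
   Context: For a word $w=w_1w_2\dots w_n\in\{0,1\}^n$ and $k\le n$, $w[:k]=w_1\dots w_k$ denotes the prefix of length $k$, and $|u|_0$ denotes the number of letters of the word $u$ equal to $0$. For a natural number $n$, an integer $r\ge1$ and $0\le\alpha\le1$, $$B_{n,\alpha,r}=\{w\in\{0,1\}^n : \text{for all } k\le n,\ \alpha k-r<|w[:k]|_0\le \alpha k+r\}.$$ *)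

(* Defs.v *)
From mathcomp Require Import all_boot all_order all_algebra.
From mathcomp Require Import all_classical all_reals all_analysis.

Set Implicit Arguments.
Unset Strict Implicit.
Unset Printing Implicit Defensive.

Import Order.TTheory GRing.Theory Num.Theory.
Import numFieldNormedType.Exports.

Local Open Scope classical_set_scope.
Local Open Scope ring_scope.

(* The letters 0 and 1 are encoded as [false] and [true]. *)
Definition num0 (u : seq bool) : nat := count_mem false u.

Definition balanced_words (R : realType) (n : nat) (alpha : R) (r : nat) :
    {set n.-tuple bool} :=
  [set w : n.-tuple bool | [forall k : 'I_n.+1,
     (alpha * k%:R - r%:R < (num0 (take k w))%:R) &&
     ((num0 (take k w))%:R <= alpha * k%:R + r%:R)]]%SET.

(* At n = 0 the exponent n%:R^-1 is 0 and the term is 1, which does not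
   affect the limit. *)
Definition root_card_balanced (R : realType) (alpha : R) (r : nat) :
    nat -> R :=
  fun n => (#|balanced_words n alpha r|%:R) `^ (n%:R^-1).

(* Meaningful only when the sequence converges. *)
Definition growth_rate (R : realType) (alpha : R) (r : nat) : R :=
  limn (root_card_balanced alpha r).

(* Main.v *)
Require Import Defs.
From mathcomp Require Import all_boot all_order all_algebra.
From mathcomp Require Import all_classical all_reals all_analysis.
From mathcomp Require Import zify ring lra.

(** Measured against the rotation by alpha, a balanced word is a path on the
    levels [0, 2r): at step [k] the letter 1 keeps the level and the letter 0
    raises it by one, except when [floor (alpha * k)] jumps, in which case the
    letter 1 lowers the level and the letter 0 keeps it.  So the number of
    balanced words is a product of two kinds of transfer operators, arranged
    along the Sturmian coding of the rotation.  Both operators dominate the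
    identity, so inserting letters into the coding never decreases the count,
    and exchanging two adjacent letters costs at most a factor 2, whatever [r]
    is.  Codings of nearby slopes, with arbitrary phases, can be matched up by
    skipping and exchanging an arbitrarily small proportion of letters: near an
    irrational slope one skips letters to align the phases, and the remaining
    discrepancies are isolated and rare; near p/q both codings are, up to few
    letters, powers of the same periodic word.  This gives the uniform
    continuity, and, applied to two phases of a single slope, it makes the
    logarithm of the count almost subadditive, so that the limit exists. *)

Set Implicit Arguments.
Unset Strict Implicit.
Unset Printing Implicit Defensive.

Import Order.TTheory GRing.Theory Num.Theory.
Import numFieldNormedType.Exports.

(** * Transfer operators on levels *)

(* One step of the path, read backwards on functions of the level; [true] marks
   a jump of the floor. *)
Definition step (h : nat) (b : bool) (f : nat -> nat) (i : nat) : nat :=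
  f i + (if b then (if i is j.+1 then f j else 0)
         else (if i.+1 < h then f i.+1 else 0)).

Definition run (h : nat) (s : seq bool) (f : nat -> nat) : nat -> nat :=
  foldr (step h) f s.

Lemma run_cat h s t f : run h (s ++ t) f = run h s (run h t f).
Proof. by rewrite /run foldr_cat. Qed.

Lemma step_mono h b k (f g : nat -> nat) :
  (forall i, f i <= k * g i) -> forall i, step h b f i <= k * step h b g i.
Proof.
move=> fg i; rewrite /step mulnDr leq_add //.
by case: b; [case: i => [|j] | case: ifP => _].
Qed.

Lemma run_mono h s k (f g : nat -> nat) :
  (forall i, f i <= k * g i) -> forall i, run h s f i <= k * run h s g i.
Proof. by move=> fg; elim: s => [//|b s IH] /=; apply: step_mono. Qed.

(** A step adds a natural number to [f i], so dropping a letter can only lower the value;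
    [step_mono] carries this through the letters before it. *)
Lemma run_subseq h s t f i : subseq s t -> run h s f i <= run h t f i.
Proof.
elim: t s i => [|b t IH] [|a s] i //=; last case: eqP => [-> st | _ st].
- by move=> _; apply: leq_trans (IH [::] i (sub0seq _)) (leq_addr _ _).
- rewrite -[leqRHS]mul1n; apply: step_mono => j.
  by rewrite mul1n IH.
- exact: leq_trans (IH _ i st) (leq_addr _ _).
Qed.

Lemma run_scale h s f k i : (forall j, f j <= k) ->
  run h s f i <= k * run h s (fun=> 1) i.
Proof. by move=> fk; apply: run_mono => j; rewrite muln1. Qed.

Lemma run1_le h s i : run h s (fun=> 1) i <= 2 ^ size s.
Proof.
elim: s i => [//|b s IH] i /=; rewrite expnS mul2n -addnn /step leq_add //.
by case: b; [case: i => [|j] | case: ifP => _].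
Qed.

Lemma run1_gt0 h s i : 0 < run h s (fun=> 1) i.
Proof. exact: leq_trans (run_subseq h (fun=> 1) i (sub0seq s)). Qed.

(** A path that starts below [h] stays below [h], so bounds on [f] there are enough. *)
Lemma run_scale_lt h s f k i : i < h -> (forall j, j < h -> f j <= k) ->
  run h s f i <= k * run h s (fun=> 1) i.
Proof.
move=> + fk; elim: s i => [|b s IH] i ih /=; first by rewrite muln1 fk.
rewrite /step mulnDr leq_add ?IH //.
case: b; last by case: ifP => // /IH.
by case: i ih => [//|j] jh; apply/IH/ltnW.
Qed.

(** The cost [2 ^ c] is the same for all [h], which is the source of the uniformity in [r]; the
    arbitrary [f] lets costs add up under concatenation. *)
Definition dom (c : nat) (s t : seq bool) : Prop :=
  forall h f i, run h s f i <= 2 ^ c * run h t f i.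

Lemma dom_subseq s t : subseq s t -> dom 0 s t.
Proof. by move=> st h f i; rewrite mul1n run_subseq. Qed.

Lemma dom_trans c d t s u : dom c s t -> dom d t u -> dom (c + d) s u.
Proof.
move=> st tu h f i; apply: leq_trans (st h f i) _.
by rewrite expnD -mulnA leq_mul2l tu orbT.
Qed.

Lemma dom_cat c d s t s' t' : dom c s s' -> dom d t t' ->
  dom (c + d) (s ++ t) (s' ++ t').
Proof.
move=> ss tt h f i; rewrite !run_cat expnD -mulnA mulnC -mulnA.
apply: leq_trans (run_mono h s (tt h f) i) _.
by rewrite leq_mul2l mulnC ss orbT.
Qed.

Lemma dom_le c d s t : c <= d -> dom c s t -> dom d s t.
Proof.
by move=> cd st h f i; apply: leq_trans (st h f i) _; rewrite leq_mul2r leq_pexp2l ?orbT.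
Qed.

(* The two orders only differ at the extreme levels, where one of the two ways
   of returning to the starting level is lost. *)
Lemma dom_swap a b : dom 1 [:: a; b] [:: b; a].
Proof.
move=> h f i; rewrite /= /step.
case: a; case: b; case: i => [|i] /=; repeat case: ifP => ? /=; try lia.
Qed.

(** * Words of jumps and their synchronization *)

Definition jumps (A : nat -> int) (n : nat) : seq bool :=
  mkseq (fun k => A k.+1 != A k) n.

Lemma jumps_cat A n m :
  jumps A (n + m) = jumps A n ++ jumps (fun k => A (n + k)) m.
Proof.
rewrite /jumps /mkseq iotaD map_cat; congr (_ ++ _).
by rewrite addnC iotaDl -map_comp; apply: eq_map => k /=; rewrite addnS.
Qed.

Lemma eq_jumps (A B : nat -> int) n :
  (forall k, k <= n -> A k = B k) -> jumps A n = jumps B n.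
Proof.
move=> AB; apply/eq_in_map => k; rewrite mem_iota add0n => /andP[_ kn].
by rewrite !AB // ltnW.
Qed.

Lemma jumpsS A n : jumps A n.+1 = (A 1 != A 0) :: jumps (fun k => A k.+1) n.
Proof. by rewrite -add1n jumps_cat. Qed.

(* [g] is a number of initial steps already known to be free of discrepancies;
   discrepancies are more than [K] apart and each one costs a single swap. *)
Lemma jumps_sync K (A B : nat -> int) n g :
  0 < K -> g <= K ->
  (forall k, (A k <= A k.+1 <= A k + 1)%R) ->
  (forall k, (B k <= B k.+1 <= B k + 1)%R) ->
  (forall k, k < g -> k <= n -> A k = B k) ->
  (forall k k', k < k' <= n -> A k <> B k -> A k' <> B k' -> K < k' - k) ->
  A 0 = B 0 -> A n = B n ->
  dom ((n + K - g) %/ K) (jumps A n) (jumps B n).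
Proof.
move=> K0; have [N] := ubnP n; elim: N n A B g => // N IH n A B g.
rewrite ltnS => nN gK mA mB ABg sep AB0 ABn.
case: n nN ABg sep ABn => [|n] nN ABg sep ABn.
  exact: dom_le (dom_subseq (subseq_refl _)).
case: (altP (A 1 =P B 1)) => [AB1 | nAB1].
  rewrite !jumpsS -cat1s -(cat1s (B 1 != B 0)) AB1 AB0 -[X in dom X]add0n.
  apply: dom_cat; first exact: dom_subseq.
  apply: (@dom_le ((n + K - g.-1) %/ K)).
    by apply: leq_div2r; lia.
  apply: IH => //; first lia.
  + by move=> k kg kn; apply: ABg; lia.
  + by move=> k k' kk; have := sep k.+1 k'.+1; rewrite subSS; apply; lia.
have g1 : g <= 1.
  by rewrite leqNgt; apply/negP => g1; move/eqP: nAB1; apply; apply: ABg.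
apply: (@dom_le ((n.+1 + K - 1) %/ K)).
  by apply: leq_div2r; lia.
move=> {ABg gK g1}.
case: n nN sep ABn => [|n] nN sep ABn; first by rewrite ABn eqxx in nAB1.
have AB2 : A 2 = B 2.
  apply/eqP/negP => /negP/eqP H.
  by have := sep 1 2 isT (elimN eqP nAB1) H; lia.
rewrite -[n.+2]/(2 + n) (jumps_cat A 2 n) (jumps_cat B 2 n).
(* One swap, then a tail whose first [K.-1] indices are known to agree; the budget fits because
   [K + (n + K - K.-1) = n + 2 + K - 1]. *)
apply: (@dom_le (1 + (n + K - K.-1) %/ K)).
  have -> : 1 + (n + K - K.-1) %/ K = (K + (n + K - K.-1)) %/ K.
    by rewrite divnDl // divnn K0.
  by apply: leq_div2r; lia.
apply: dom_cat.
  rewrite /jumps /mkseq /= -AB0 -AB2.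
  (* The two sequences agree at 0 and 2 and differ at 1, so one jumps first and the other second. *)
  have -> : (A 1 != A 0) = (A 2 != B 1) by move: (mA 0) (mA 1) (mB 0) (mB 1); lia.
  have -> : (A 2 != A 1) = (B 1 != A 0) by move: (mA 0) (mA 1) (mB 0) (mB 1); lia.
  exact: dom_swap.
apply: IH => //; [lia | lia | | ].
+ move=> k kK kn; apply/eqP/negP => /negP/eqP H.
  by have := sep 1 (2 + k) _ (elimN eqP nAB1) H; lia.
+ by move=> k k' kk H H'; have := sep (2 + k) (2 + k') _ H H'; lia.
Qed.

(** * Codings of rotations *)

Local Open Scope classical_set_scope.
Local Open Scope ring_scope.

Lemma jumps_addz (A : nat -> int) z n : jumps (fun k => A k + z) n = jumps A n.
Proof. by apply: eq_map => k; rewrite (inj_eq (addIr z)). Qed.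

Lemma size_jumps A n : size (jumps A n) = n.
Proof. exact: size_mkseq. Qed.

Lemma subseq_jumps A s n m : (s + n <= m)%N ->
  subseq (jumps (fun k => A (s + k)%N) n) (jumps A m).
Proof.
move=> snm; rewrite -(subnKC snm) !jumps_cat.
exact: subseq_trans (suffix_subseq _ _) (prefix_subseq _ _).
Qed.

Lemma jumps_true A n : A n <> A 0%N -> true \in jumps A n.
Proof.
elim: n A => [//|n IH] A; rewrite jumpsS inE => An.
case: (altP (A 1%N =P A 0%N)) => //= A10.
by apply: IH; rewrite A10.
Qed.

Lemma jumps_false A n : (forall k, A k <= A k.+1 <= A k + 1) ->
  A n <> A 0%N + n%:Z -> false \in jumps A n.
Proof.
elim: n A => [|n IH] A mA An; first by rewrite addr0 in An.
rewrite jumpsS inE; case: (altP (A 1%N =P A 0%N)) => //= A10; apply: IH => //.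
by move: (mA 0%N) An A10; lia.
Qed.

Definition rotation (R : realType) (a x : R) (k : nat) : int :=
  Num.floor (x + a * k%:R).

Definition mech (R : realType) (a x : R) (n : nat) : seq bool :=
  jumps (rotation a x) n.

Lemma rotation_step (R : realType) (a x : R) k : 0 < a < 1 ->
  rotation a x k <= rotation a x k.+1 <= rotation a x k + 1.
Proof.
move=> a01; rewrite /rotation; apply/andP; split.
  by apply: le_floor; rewrite -natr1; nra.
rewrite -ltzD1 floor_lt_int !intrD -natr1.
have := floorD1_gt (x + a * k%:R); rewrite intrD; nra.
Qed.

Lemma rotationD (R : realType) (a x : R) s k :
  rotation a x (s + k) = rotation a (x + a * s%:R) k.
Proof. by rewrite /rotation natrD mulrDr addrA. Qed.

Lemma mech_cat (R : realType) (a x : R) n m :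
  mech a x (n + m) = mech a x n ++ mech a (x + a * n%:R) m.
Proof.
by rewrite /mech jumps_cat; congr (_ ++ _); apply: eq_jumps => k _; rewrite rotationD.
Qed.

Lemma mech_addz (R : realType) (a x : R) (z : int) n : mech a (x + z%:~R) n = mech a x n.
Proof.
rewrite /mech -[RHS](jumps_addz _ z); apply: eq_jumps => k _.
by rewrite /rotation addrAC floorDrz ?intr_int // intrKfloor.
Qed.

Lemma subseq_mech (R : realType) (a x : R) s n m : (s + n <= m)%N ->
  subseq (mech a (x + a * s%:R) n) (mech a x m).
Proof.
move=> snm; have := subseq_jumps (rotation a x) snm.
by congr subseq; apply: eq_jumps => k _; rewrite rotationD.
Qed.

Lemma subseq_mech0 (R : realType) (a x : R) n m : (n <= m)%N ->
  subseq (mech a x n) (mech a x m).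
Proof. by move=> nm; rewrite -(subnKC nm) mech_cat prefix_subseq. Qed.

(** Heights of the rotation by [p / q] from phase 0; for coprime [p < q] the jumps over one period
    spell a Christoffel word. *)
Definition christoffel (p q k : nat) : int := (k * p %/ q)%N.

Lemma christoffelD p q s k : (0 < q)%N ->
  christoffel p q (s * q + k) = christoffel p q k + (s * p)%N%:Z.
Proof. by move=> q0; rewrite /christoffel mulnDl mulnAC divnMDl // PoszD addrC. Qed.

Lemma christoffel_step p q k : (p < q)%N ->
  christoffel p q k <= christoffel p q k.+1 <= christoffel p q k + 1.
Proof.
move=> pq.
rewrite /christoffel mulSn lez_nat leq_div2r ?leq_addl //=.
have q0 : (0 < q)%N by lia.
suff : ((p + k * p) %/ q <= k * p %/ q + 1)%N by lia.
have -> : (k * p %/ q + 1 = (q + k * p) %/ q)%N by rewrite divnDl // divnn q0 addnC.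
by apply: leq_div2r; lia.
Qed.

Definition periods p q N := jumps (christoffel p q) (N * q).

Lemma periods_cat p q N N' : (0 < q)%N ->
  periods p q (N + N') = periods p q N ++ periods p q N'.
Proof.
move=> q0.
rewrite /periods mulnDl jumps_cat; congr (_ ++ _).
rewrite -[RHS](jumps_addz _ (N * p)%N); apply: eq_jumps => k _.
exact: christoffelD.
Qed.

(** The height rises over a period by [p], which is neither 0 nor [q], so both letters occur. *)
Lemma letter_periods p q b : (0 < p < q)%N -> subseq [:: b] (periods p q 1).
Proof.
move=> /andP[p0 pq]; have q0 : (0 < q)%N by lia.
rewrite sub1seq /periods mul1n; case: b; [apply: jumps_true | apply: jumps_false].
- by rewrite /christoffel mul0n div0n mulKn; lia.
- by move=> k; apply: christoffel_step.
- by rewrite /christoffel mul0n div0n mulKn; lia.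
Qed.

(** * Slopes near a rational *)

(** The hypothesis says that [x + a * k] and [(A + k * p) / q] have the same floor. As [p] is
    invertible modulo [q], [A] is congruent to some [s * p], which gives the phase. *)
Lemma mech_christoffel (R : realType) p q (a x : R) n (A : int) :
  (0 < p)%N -> (0 < q)%N -> coprime p q ->
  (forall k, (k <= n)%N ->
     A%:~R <= q%:R * x + k%:R * (q%:R * a - p%:R) < A%:~R + 1) ->
  exists2 s, (s < q)%N &
    mech a x n = jumps (fun k => christoffel p q (s + k)%N) n.
Proof.
move=> p0 q0 cpq HA.
have [u v uv _] := egcdnP q p0; rewrite (eqP cpq) in uv.
pose A' := `|(A %% q)%Z|%N; pose z := (A %/ q)%Z.
have EA : A = A'%:Z + q%:Z * z.
  rewrite /A' gez0_abs ?modz_ge0 //; last lia.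
  by rewrite [LHS](divz_eq A q) addrC mulrC.
pose s := (A' * u %% q)%N; pose t := (A' * u %/ q)%N.
have Es : (A' * u = t * q + s)%N := divn_eq _ _.
exists s; first by rewrite ltn_mod.
(* Here [A = s * p + q * w], and the constant shift [w] of the heights does not change the jumps. *)
rewrite /mech; pose w : int := z - (A' * v)%N%:Z + (t * p)%N%:Z.
rewrite -[RHS](jumps_addz _ w); apply: eq_jumps => k kn.
rewrite /rotation; apply: floor_def.
rewrite /christoffel; set D := ((s + k) * p %/ q)%N.
pose rho := ((s + k) * p %% q)%N.
have ED : ((s + k) * p = D * q + rho)%N := divn_eq _ _.
have rq : (rho < q)%N by rewrite ltn_mod.
have EZ : A + (k * p)%N%:Z = q%:Z * (D%:Z + w) + rho%:Z.
  have E2 : (A' * u * p = A' * v * q + A')%N by rewrite -mulnA uv mulnDr mulnA muln1.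
  rewrite Es in E2; rewrite EA /w; move: E2 ED.
  by move=> /(congr1 Posz) E2 /(congr1 Posz) E3; rewrite !(PoszD, PoszM) in E2 E3 *; nia.
have ER : A%:~R + k%:R * p%:R = q%:R * (D%:Z + w)%:~R + rho%:R :> R.
  by have := congr1 (fun i : int => i%:~R : R) EZ; rewrite !(intrD, intrM, PoszM) /=.
have qR : 0 < q%:R :> R by rewrite ltr0n.
have r1 : rho%:R + 1 <= q%:R :> R by rewrite natr1 ler_nat.
have r0 : 0 <= rho%:R :> R by [].
have /andP[H1 H2] := HA k kn.
rewrite intrD -(ler_pM2l qR) -(ltr_pM2l qR) mulrDr.
by apply/andP; split; lra.
Qed.

Lemma monotone_two_values (F : nat -> int) m :
  (forall i j, (i <= j)%N -> F i <= F j) \/ (forall i j, (i <= j)%N -> F j <= F i) ->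
  `|F m - F 0%N| <= 1 ->
  exists k1, [/\ (k1 <= m)%N, forall k, (k < k1)%N -> F k = F 0%N &
    forall k, (k1 <= k <= m)%N -> F k = F m].
Proof.
move=> mF Fm.
have ex : exists k, F k == F m by exists m.
have [k1 /eqP Fk1 k1min] := ex_minnP ex.
have k1m : (k1 <= m)%N by apply: k1min.
exists k1; split=> // k.
  move=> kk1; have /negP/negP nk : ~ F k == F m by move/k1min; lia.
  case: mF => mF.
    by have := mF 0%N k isT; have := mF k m; move/eqP: nk; lia.
  by have := mF 0%N k isT; have := mF k m; move/eqP: nk; lia.
move=> /andP[k1k km].
by case: mF => mF; have := mF _ _ k1k; have := mF _ _ km; lia.
Qed.

(* Since [a] is close to [p / q], the cell of width [1 / q] containing
   [x + k (a - p / q)] changes at most once for [k <= m]. *)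
Lemma mech_near_rational (R : realType) p q (a x : R) m :
  (0 < p)%N -> (0 < q)%N -> coprime p q ->
  m%:R * `|q%:R * a - p%:R| < 1 ->
  exists k1 s1 s2, [/\ (k1 <= m)%N, (s1 < q)%N, (s2 < q)%N,
    mech a x k1.-1 = jumps (fun k => christoffel p q (s1 + k)%N) k1.-1 &
    mech a (x + a * k1%:R) (m - k1) =
      jumps (fun k => christoffel p q (s2 + k)%N) (m - k1)].
Proof.
move=> p0 q0 cpq; set th := q%:R * a - p%:R => mth.
pose y k : R := q%:R * x + k%:R * th.
pose F k : int := Num.floor (y k).
have Fitv k : (F k)%:~R <= y k < (F k)%:~R + 1.
  by have := floor_itv (y k); rewrite intrD.
have [||k1 [k1m H1 H2]] := @monotone_two_values F m.
- case: (leP 0 th) => th0; [left|right] => i j ij; apply: le_floor;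
  rewrite lerD2l; have : i%:R <= j%:R :> R by [rewrite ler_nat]; nra.
- have y0m : y m = y 0%N + m%:R * th by rewrite /y mul0r addr0.
  have : `|m%:R * th| < 1 by rewrite normrM ger0_norm.
  rewrite ltr_norml => /andP[c1 c2].
  have /andP[a1 a2] := Fitv m; have /andP[b1 b2] := Fitv 0%N.
  have : (F m - F 0%N)%:~R < 2%:~R :> R by rewrite intrB; lra.
  have : (-2)%:~R < (F m - F 0%N)%:~R :> R by rewrite intrB; lra.
  by rewrite !ltr_int; lia.
(* A word of [n] letters reads the heights at 0 through [n], so the cell that is constant before
   [k1] controls only [k1.-1] letters; the letter across the change is left out. *)
have [|s1 s1q E1] := @mech_christoffel R p q a x k1.-1 (F 0%N) p0 q0 cpq.
  move=> k kk1; case: k1 H1 {H2} kk1 k1m => [|k1] H1 /= kk1 k1m.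
    by move: kk1; rewrite leqn0 => /eqP ->; apply: Fitv.
  by rewrite -(H1 k) //; apply: Fitv.
(* Restarting at time [k1] adds [q * a * k1] to [q * x], that is, the drift so far plus [k1 * p]. *)
have [|s2 s2q E2] := @mech_christoffel R p q a (x + a * k1%:R) (m - k1)
  (F m + (k1 * p)%N%:Z) p0 q0 cpq.
  move=> k kk1; have := Fitv (k1 + k)%N; rewrite H2; last by lia.
  have -> : (F m + (k1 * p)%N%:Z)%:~R = (F m)%:~R + k1%:R * p%:R :> R.
    by rewrite intrD -pmulrn natrM.
  by rewrite /y natrD /th; lra.
by exists k1, s1, s2.
Qed.

Lemma jumps_christoffel_le p q s n N : (0 < q)%N ->
  (s + n <= N * q)%N ->
  subseq (jumps (fun k => christoffel p q (s + k)%N) n) (periods p q N).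
Proof. by move=> q0; apply: subseq_jumps. Qed.

(** Skipping [q - s] letters reaches the start of a period, at the price of at most one period. *)
Lemma periods_le_jumps p q s n N : (s <= q)%N -> (0 < q)%N ->
  (N.+1 * q <= n)%N ->
  subseq (periods p q N) (jumps (fun k => christoffel p q (s + k)%N) n).
Proof.
move=> sq q0 Nn.
have -> : periods p q N = jumps (fun k => christoffel p q (s + ((q - s) + k)))%N (N * q).
  rewrite /periods -[LHS](jumps_addz _ p); apply: eq_jumps => k _.
  by rewrite addnA subnKC // -[X in christoffel _ _ (X + _)%N]mul1n christoffelD // mul1n.
by apply: (@subseq_jumps (fun k => christoffel p q (s + k)%N)); lia.
Qed.

(** Each of the two pieces needs at most two extra periods to round its phase and its length, and
    the letter between them one more: five in all. *)
Lemma mech_le_periods (R : realType) p q (a x : R) t :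
  (0 < p < q)%N -> coprime p q ->
  (q * t)%:R * `|q%:R * a - p%:R| < 1 ->
  subseq (mech a x (q * t)) (periods p q (t + 5)).
Proof.
move=> pq cpq /(mech_near_rational x) H.
have [|| //|k1 [s1 [s2 [k1m s1q s2q E1 E2]]]] := H; try lia.
have q0 : (0 < q)%N by lia.
rewrite -(subnKC k1m) mech_cat E2.
have H1 : subseq (mech a x k1) (periods p q (k1 %/ q + 2 + 1)).
  rewrite periods_cat //; case: k1 E1 {E2 k1m} => [|k1] /= E1.
    exact: sub0seq.
  rewrite -addn1 mech_cat E1; apply: cat_subseq; last exact: letter_periods.
  apply: jumps_christoffel_le => //.
  by have := divn_eq (k1 + 1) q; have := @ltn_mod (k1 + 1) q; lia.
pose N1 := (k1 %/ q + 2)%N; pose N2 := ((q * t - k1) %/ q + 2)%N.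
have N12 : (N1 + N2 + 1 <= t + 5)%N.
  rewrite /N1 /N2; have := leq_trunc_div k1 q; have := leq_trunc_div (q * t - k1) q.
  by nia.
apply: (@subseq_trans _ (periods p q (k1 %/ q + 2 + 1) ++ periods p q N2)).
  apply: cat_subseq H1 _.
  apply: jumps_christoffel_le => //; rewrite /N2.
  by have := divn_eq (q * t - k1) q; have := @ltn_mod (q * t - k1) q; lia.
rewrite -periods_cat // addnAC -(subnKC N12) [X in subseq _ X]periods_cat //.
exact: prefix_subseq.
Qed.

(** Each piece gives up one period for alignment and a partial one at its end, and the letter
    between them is discarded; five spare periods cover these losses. *)
Lemma periods_le_mech (R : realType) p q (a x : R) t :
  (0 < p < q)%N -> coprime p q ->
  (q * (t + 5))%:R * `|q%:R * a - p%:R| < 1 ->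
  subseq (periods p q t) (mech a x (q * (t + 5))).
Proof.
move=> pq cpq /(mech_near_rational x) H.
have [|| //|k1 [s1 [s2 [k1m s1q s2q E1 E2]]]] := H; try lia.
have q0 : (0 < q)%N by lia.
have {H} -> : mech a x (q * (t + 5)) =
    mech a x k1 ++ mech a (x + a * k1%:R) (q * (t + 5) - k1).
  by rewrite -mech_cat subnKC.
rewrite E2.
pose N1 := ((k1.-1) %/ q).-1%N; pose N2 := ((q * (t + 5) - k1) %/ q).-1%N.
have Ek := divn_eq k1.-1 q; have Ek' := divn_eq (q * (t + 5) - k1) q.
have := @ltn_mod (q * (t + 5) - k1) q; have := @ltn_mod k1.-1 q.
rewrite q0 => L1 L2.
have N12 : (t <= N1 + N2)%N by rewrite /N1 /N2; nia.
have H1 : subseq (periods p q N1) (mech a x k1).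
  apply: (@subseq_trans _ (mech a x k1.-1)); last by apply: subseq_mech0; lia.
  rewrite E1 /N1.
  case: (k1.-1 %/ q)%N Ek => [|j] Ek /=; first exact: sub0seq.
  by apply: periods_le_jumps => //; lia.
have H2 : subseq (periods p q N2)
    (jumps (fun k => christoffel p q (s2 + k)%N) (q * (t + 5) - k1)).
  rewrite /N2; case: ((q * (t + 5) - k1) %/ q)%N Ek' => [|j] Ek' /=; first exact: sub0seq.
  by apply: periods_le_jumps => //; lia.
apply: subseq_trans (cat_subseq H1 H2); rewrite -periods_cat //.
by rewrite -(subnKC N12) [X in subseq _ X]periods_cat // prefix_subseq.
Qed.

(** * Slopes near an irrational *)

(** Dirichlet's pigeonhole argument: [N.+1] fractional parts fall into [N] boxes of width
    [1 / N <= eta]. *)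
Lemma dirichlet_approx (R : realType) (a eta : R) : 0 < eta ->
  exists2 q : nat, (0 < q)%N & exists z : int, `|a * q%:R - z%:~R| <= eta.
Proof.
move=> eta0; pose N := (Num.truncn eta^-1).+1.
have NR : 0 < N%:R :> R by rewrite ltr0n.
have Neta : N%:R^-1 <= eta.
  by rewrite invf_ple ?posrE // ltW // truncnS_gt.
pose y (i : nat) := a * i%:R.
pose frac i := y i - (Num.floor (y i))%:~R.
have fr i : 0 <= frac i < 1.
  by have := floor_itv (y i); rewrite /frac intrD; lra.
have frN i : 0 <= N%:R * frac i by rewrite mulr_ge0 //; have := fr i; lra.
pose f (i : 'I_N.+1) : 'I_N := inord (Num.truncn (N%:R * frac i)).
have fE i : f i = Num.truncn (N%:R * frac i) :> nat.
  rewrite /f inordK // -(ltr_nat R).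
  have /andP[+ _] := truncn_itv (frN i); move/le_lt_trans; apply.
  by rewrite gtr_pMr //; have := fr i; lra.
have /injectivePn [i [j ij fij]] : ~~ injectiveb f.
  by apply/negP => /injectiveP /leq_card; rewrite !card_ord ltnn.
wlog lij : i j ij fij / (i < j)%N.
  move=> H; case: (ltngtP i j) => [lij | lij | /val_inj e]; first exact: (H i j).
  - by apply: (H j i) => //; rewrite eq_sym.
  - by rewrite e eqxx in ij.
exists (j - i)%N; first by rewrite subn_gt0.
exists (Num.floor (y j) - Num.floor (y i)).
have -> : a * (j - i)%:R - (Num.floor (y j) - Num.floor (y i))%:~R = frac j - frac i.
  by rewrite intrB natrB 1?ltnW // /frac /y; ring.
apply: le_trans Neta.
have := truncn_itv (frN i); have := truncn_itv (frN j).
rewrite -!fE fij -natr1 => /andP[A1 A2] /andP[B1 B2].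
rewrite -(ler_pM2l NR) divff ?gt_eqF // -[X in X * _]gtr0_norm // -normrM.
by rewrite ler_norml mulrBr; lra.
Qed.

(** Steps of length [|th|] must land within [|th|] of the next integer, and about [1 / |th|] of them
    suffice from any [x]. A negative [th] is handled by reflection. *)
Lemma multiples_near_integers (R : realType) (th : R) : th != 0 ->
  exists J : nat, forall x : R, exists2 j : nat, (j <= J)%N &
    exists w : int, `|x + j%:R * th - w%:~R| <= `|th|.
Proof.
wlog th0 : th / 0 < th.
  move=> H thn0; case: (ltgtP th 0) => [t0|t0|e]; last by rewrite e eqxx in thn0.
  - have [||J HJ] := H (- th); rewrite ?oppr_gt0 ?oppr_eq0 //.
    exists J => x; have [j jJ [w Hw]] := HJ (- x).
    exists j => //; exists (- w); rewrite -normrN -[leRHS]normrN.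
    apply: le_trans Hw; rewrite le_eqVlt; apply/orP; left; apply/eqP; congr (`| _ |).
    by rewrite intrN; ring.
  - exact: H.
move=> _; exists (Num.truncn th^-1) => x.
pose d := (Num.floor x)%:~R + 1 - x.
have d01 : 0 < d <= 1 by have := floor_itv x; rewrite /d intrD; lra.
have dth : 0 <= d / th by rewrite divr_ge0 //; lra.
(* The last multiple of [th] not exceeding the distance [d] to the next integer. *)
exists (Num.truncn (d / th)).
  by apply: le_truncn; rewrite ler_pdivrMr // mulVf ?gt_eqF //; lra.
exists (Num.floor x + 1).
have := truncn_itv dth; rewrite ler_pdivlMr // ltr_pdivrMr // -natr1.
rewrite (gtr0_norm th0) ler_norml intrD /d; set j := _%:R; lra.
Qed.

Definition irrational_slope (R : realType) (a : R) : Prop :=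
  forall (i : nat) (z : int), (0 < i)%N -> a * i%:R != z%:~R.

(** Moving [q] letters at a time, with [q] from Dirichlet's argument, shifts the phase modulo 1 by
    at most [eta], and by a nonzero amount since the slope is irrational. *)
Lemma irrational_dense (R : realType) (a eta : R) : irrational_slope a -> 0 < eta ->
  exists M : nat, forall x : R, exists2 s : nat, (s <= M)%N &
    exists z : int, `|x + a * s%:R - z%:~R| <= eta.
Proof.
move=> irr eta0; have [q q0 [z Hz]] := dirichlet_approx a eta0.
have [|J HJ] := @multiples_near_integers R (a * q%:R - z%:~R).
  by rewrite subr_eq0 irr.
exists (q * J)%N => x; have [j jJ [w Hw]] := HJ x.
exists (q * j)%N; first by rewrite leq_mul2l jJ orbT.
exists (w + j%:Z * z); apply: le_trans Hz; apply: le_trans Hw.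
rewrite le_eqVlt; apply/orP; left; apply/eqP; congr (`| _ |).
by rewrite intrD intrM natrM -pmulrn; ring.
Qed.

Lemma irrational_gap (R : realType) (a : R) K : irrational_slope a ->
  exists2 eta : R, 0 < eta & forall i (z : int), (0 < i <= K)%N ->
    eta <= `|a * i%:R - z%:~R|.
Proof.
move=> irr; elim: K => [|K [eta eta0 H]].
  by exists 1 => // i z /andP[i0]; rewrite leqn0 => /eqP i00; rewrite i00 in i0.
pose y := a * K.+1%:R; pose u := y - (Num.floor y)%:~R.
have u0 : 0 < u.
  have := irr K.+1 (Num.floor y) isT; rewrite -/y -subr_eq0 -/u.
  by move=> un; rewrite lt_def un subr_ge0; case/andP: (floor_itv y).
have u1 : u < 1 by have := floor_itv y; rewrite /u intrD; lra.
exists (Num.min eta (Num.min u (1 - u))); first by rewrite !lt_min eta0 u0 subr_gt0.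
move=> i z /andP[i0]; rewrite leq_eqVlt ltnS => /orP[/eqP -> | iK]; last first.
  by rewrite ge_min H // i0.
rewrite !ge_min -/y; apply/orP; right.
case: (leP z (Num.floor y)) => zf.
  have zR : z%:~R <= (Num.floor y)%:~R :> R by rewrite ler_int.
  by apply/orP; left; rewrite ler_normr; apply/orP; left; rewrite /u; lra.
have zR : (Num.floor y + 1)%:~R <= z%:~R :> R by rewrite ler_int; lia.
apply/orP; right; rewrite ler_normr; apply/orP; right.
by move: zR; rewrite intrD /u; lra.
Qed.

(** An integer separates [x] from [y], and it is no farther from [x] than [y] is. *)
Lemma floor_neq_near_int (R : realType) (x y e : R) : `|x - y| <= e ->
  Num.floor x <> Num.floor y -> exists z : int, `|x - z%:~R| <= e.
Proof.
move=> xy nf; have := floor_itv x; have := floor_itv y; rewrite !intrD.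
move: xy; rewrite ler_norml => /andP[xy1 xy2] /andP[fy1 fy2] /andP[fx1 fx2].
have [lt|lt|//] := ltgtP (Num.floor x) (Num.floor y).
- have zR : (Num.floor x + 1)%:~R <= (Num.floor y)%:~R :> R by rewrite ler_int; lia.
  rewrite intrD in zR.
  by exists (Num.floor y); rewrite ler_norml; lra.
- have zR : (Num.floor y + 1)%:~R <= (Num.floor x)%:~R :> R by rewrite ler_int; lia.
  rewrite intrD in zR.
  by exists (Num.floor x); rewrite ler_norml; lra.
Qed.

(** * Comparable blocks near an arbitrary slope *)

(** Slopes may coincide and phases are arbitrary, so the property serves the continuity and, with
    [a = a'], the existence of the limit. *)
Definition comparable_blocks (R : realType) (a0 eps : R) : Prop :=
  exists2 delta : R, 0 < delta & exists m M c : nat,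
    [/\ (0 < m)%N, M%:R <= eps * m%:R, c%:R <= eps * m%:R &
      forall a a' : R, 0 < a < 1 -> 0 < a' < 1 ->
        `|a - a0| < delta -> `|a' - a0| < delta ->
        forall x x', dom c (mech a x m) (mech a' x' (m + M))].

Lemma exists_large_nat (R : realType) (eps C : R) : 0 < eps ->
  exists2 n : nat, (0 < n)%N & C <= eps * n%:R.
Proof.
move=> eps0; exists (Num.truncn (C / eps)).+1 => //.
by rewrite mulrC -ler_pdivrMr // ltW // truncnS_gt.
Qed.

(** Both codings are compared with the same [t + 5] periods: only skipping is needed, so the
    exchange cost is 0 and the excess is [5 + 5] periods. *)
Lemma rational_blocks (R : realType) (a0 eps : R) (p q : nat) :
  0 < a0 < 1 -> 0 < eps -> (0 < q)%N -> a0 * q%:R = p%:R ->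
  comparable_blocks a0 eps.
Proof.
move=> a01 eps0 q0 E.
wlog cpq : p q q0 E / coprime p q.
  move=> H; have g0 : (0 < gcdn p q)%N by rewrite gcdn_gt0 q0 orbT.
  apply: (H (p %/ gcdn p q)%N (q %/ gcdn p q)%N).
  - by rewrite divn_gt0 // dvdn_leq // dvdn_gcdr.
  - have gR : (gcdn p q)%:R != 0 :> R by rewrite pnatr_eq0 -lt0n.
    apply: (mulIf gR); rewrite -mulrA -!natrM !divnK ?dvdn_gcdl ?dvdn_gcdr //.
  - rewrite /coprime -(eqn_pmul2r g0) muln_gcdl !divnK ?dvdn_gcdl ?dvdn_gcdr //.
    by rewrite mul1n.
have qR : 0 < q%:R :> R by rewrite ltr0n.
have pq : (0 < p < q)%N.
  by rewrite -(ltr_nat R) -[(p < q)%N](ltr_nat R) -E; apply/andP; split; nra.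
have [t t0 Ht] := @exists_large_nat R eps 10 eps0.
(* [X] is the longest length involved; the drift [X * q * |a - a0|] has to stay below 1, whence the
   radius [1 / (q * X + 1)]. *)
pose X : R := (q * (t + 10))%:R.
have X0 : 0 <= X by [].
have D0 : 0 < q%:R * X + 1 by apply: ltr_wpDl => //; apply: mulr_ge0 => //; apply: ltW.
have near a m : (m <= q * (t + 10))%N -> `|a - a0| < (q%:R * X + 1)^-1 ->
    m%:R * `|q%:R * a - p%:R| < 1.
  move=> mX aa; have -> : q%:R * a - p%:R = q%:R * (a - a0) by rewrite -E; ring.
  rewrite normrM (gtr0_norm qR).
  have mX' : m%:R <= X by rewrite ler_nat.
  move: aa; rewrite -[_^-1]mul1r ltr_pdivlMr // => aa.
  have n0 := normr_ge0 (a - a0).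
  have : m%:R * (q%:R * `|a - a0|) <= X * (q%:R * `|a - a0|).
    by rewrite ler_wpM2r // mulr_ge0 // ltW.
  by nra.
exists (q%:R * X + 1)^-1; first by rewrite invr_gt0.
exists (q * t)%N, (q * 10)%N, 0%N; split.
- by rewrite muln_gt0 q0.
- by rewrite !natrM mulrCA ler_pM2l.
- by rewrite mulr_ge0 // ltW.
move=> a a' a1 a1' aa aa' x x'; apply: dom_subseq.
apply: (@subseq_trans _ (periods p q (t + 5))).
  apply: (mech_le_periods x pq cpq (near a (q * t)%N _ aa)).
  by rewrite leq_mul2l leq_addr orbT.
rewrite -mulnDr (_ : t + 10 = t + 5 + 5)%N; last by rewrite -addnA.
by apply: (periods_le_mech x' pq cpq (near a' _ _ aa')); rewrite -addnA.
Qed.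

(** After skipping at most [M0] letters the phases nearly agree modulo 1, and the floors differ only
    when the orbit is within [3 * eta] of an integer. Two such visits within [K] steps would bring a
    multiple of [a0] too close to an integer, so [jumps_sync] applies. *)
Lemma irrational_blocks (R : realType) (a0 eps : R) :
  irrational_slope a0 -> 0 < eps -> comparable_blocks a0 eps.
Proof.
move=> irr eps0.
(* The 2 comes from [m + 2 + K <= 2 * m] in the bound on the number of swaps. *)
have [K K0 HK] := @exists_large_nat R eps 2 eps0.
have [eta8 eta80 gap] := @irrational_gap R a0 K irr.
(* The 8 leaves room for two distances of [3 * eta] and a drift of [eta / 2]. *)
pose eta := eta8 / 8; have eta0 : 0 < eta by rewrite divr_gt0.
have gap8 i (z : int) : (0 < i <= K)%N -> 8 * eta <= `|a0 * i%:R - z%:~R|.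
  by move=> /gap H; apply: le_trans (H z); rewrite /eta; lra.
have [M0 dense] := irrational_dense irr eta0.
have [m1 m10 Hm1] := @exists_large_nat R eps (M0 + 2)%:R eps0.
have [m m1m Km] : exists2 m, (m1 <= m)%N & (K + 2 <= m)%N.
  by exists (m1 + (K + 2))%N; rewrite ?leq_addr ?leq_addl.
(* [T] bounds every time at which drift is measured: the skip and the indices in the block. *)
have [T M0T mT] : exists2 T, (M0 <= T)%N & (m + 2 <= T)%N.
  by exists (M0 + (m + 2))%N; rewrite ?leq_addr ?leq_addl.
have T0 : 0 < T.+1%:R :> R by rewrite ltr0n.
pose delta := eta / (2 * T.+1%:R).
have delta0 : 0 < delta by rewrite divr_gt0 // mulr_gt0.
exists delta => //; exists m, (M0 + 2)%N, ((m + 2 + K) %/ K)%N; split.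
- by rewrite (leq_trans _ m1m).
- by apply: le_trans Hm1 _; rewrite ler_pM2l // ler_nat.
- have KR : 0 < K%:R :> R by rewrite ltr0n.
  rewrite -(ler_pM2r KR) -natrM; apply: (@le_trans _ _ (m + 2 + K)%:R).
    by rewrite ler_nat leq_trunc_div.
  have mK : (K + 2)%:R <= m%:R :> R by rewrite ler_nat.
  rewrite -addnA natrD addnC; have m0 : 0 <= m%:R :> R by [].
  rewrite mulrAC; have := ler_wpM2r m0 HK; lra.
move=> a a' a01 a01' aa aa' x x'.
have drift (b : R) k : `|b - a0| < delta -> (k <= T)%N -> `|(b - a0) * k%:R| <= eta / 2.
  move=> ba kT; rewrite normrM normr_nat.
  have kR : k%:R <= T.+1%:R :> R by rewrite ler_nat leqW.
  apply: (@le_trans _ _ (delta * T.+1%:R)).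
    by apply: ler_pM => //; exact: ltW.
  by rewrite /delta invfM mulrA divfK ?gt_eqF //; lra.
pose near_int y := exists z : int, `|y - z%:~R| <= 3 * eta.
have far y k : (0 < k <= K)%N -> near_int y -> near_int (y + a * k%:R) -> False.
  move=> kK [z Hz] [z' Hz'].
  have kT : (k <= T)%N by move: kK Km mT; clear; lia.
  have g := gap8 k (z' - z) kK; have d := drift a k aa kT.
  suff : `|a0 * k%:R - (z' - z)%:~R| < 8 * eta by rewrite ltNge g.
  rewrite intrB; move: d Hz Hz'; rewrite !ler_norml ltr_norml.
  move=> /andP[? ?] /andP[? ?] /andP[? ?].
  by apply/andP; split; lra.
(* [jumps_sync] needs agreement at both ends. Consecutive phases are never both near an integer, so
   one step back at the start, and a choice between [m.+1] and [m + 2] at the end, secures it. *)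
have [x0 [x0x far0]] : exists x0, (x0 = x \/ x0 = x - a) /\ ~ near_int x0.
  have [nx|nx] := pselect (near_int x); last by exists x; split; [left|].
  exists (x - a); split; [by right|] => nx'.
  by apply: (far (x - a) 1%N) => //; rewrite mulr1 subrK.
have [m0 [mm0 m0m farm]] : exists m0,
    [/\ (m < m0)%N, (m0 <= m + 2)%N & ~ near_int (x0 + a * m0%:R)].
  have [nx|nx] := pselect (near_int (x0 + a * m.+1%:R)).
    exists (m + 2)%N; split=> [||nx'] //; first by rewrite addn2.
    apply: (far (x0 + a * m.+1%:R) 1%N) => //.
    by rewrite -addrA -mulrDr -natrD addn1 -addn2.
  by exists m.+1; split=> //; rewrite addn2.
have [s sM [z Hz]] := dense (x' - x0).
pose x1 := x' + a' * s%:R.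
have step1 : subseq (mech a x m) (mech a x0 m0).
  case: x0x => ->; first by apply: subseq_mech0; apply: ltnW.
  have {1}-> : x = x - a + a * 1%:R by rewrite mulr1 subrK.
  by apply: subseq_mech; rewrite add1n.
have step3 : subseq (mech a' (x1 - z%:~R) m0) (mech a' x' (m + (M0 + 2))).
  by rewrite -intrN mech_addz; apply: subseq_mech; move: sM m0m; clear; lia.
rewrite -[X in dom X]addn0; apply: dom_trans (dom_subseq step3).
rewrite -[X in dom X]add0n; apply: dom_trans (dom_subseq step1) _.
apply: (@dom_le ((m0 + K - 0) %/ K)); first by rewrite subn0 leq_div2r // leq_add2r.
have close k : (k <= m0)%N ->
    `|(x0 + a * k%:R) - (x1 - z%:~R + a' * k%:R)| <= 3 * eta.
  move=> km; have kT : (k <= T)%N by apply: leq_trans mT; apply: leq_trans m0m.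
  have k1 := drift a k aa kT; have k2 := drift a' k aa' kT.
  have k3 := drift a' s aa' (leq_trans sM M0T).
  move: k1 k2 k3 Hz; rewrite !ler_norml /x1.
  move=> /andP[? ?] /andP[? ?] /andP[? ?] /andP[? ?].
  by apply/andP; split; lra.
have mis k : (k <= m0)%N -> rotation a x0 k <> rotation a' (x1 - z%:~R) k ->
    near_int (x0 + a * k%:R).
  by move=> /close /floor_neq_near_int; apply.
apply: jumps_sync => //.
- by move=> k; apply: rotation_step.
- by move=> k; apply: rotation_step.
- move=> k k' /andP[kk km] n1 n2; rewrite ltnNge; apply/negP => kK.
  apply: (far (x0 + a * k%:R) (k' - k)%N); first by rewrite subn_gt0 kk.
    by apply: mis n1; apply: ltnW (leq_trans kk km).
  by rewrite -addrA -mulrDr -natrD subnKC 1?ltnW //; apply: mis n2.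
- apply/eqP/negP => /negP/eqP /(mis 0%N); rewrite mulr0 addr0; auto.
- by apply/eqP/negP => /negP/eqP /(mis m0); auto.
Qed.

Lemma blocks (R : realType) (a0 eps : R) : 0 < a0 < 1 -> 0 < eps ->
  comparable_blocks a0 eps.
Proof.
move=> a01 eps0.
have [[p [q [q0 E]]]|irr] := pselect (exists p q : nat, (0 < q)%N /\ a0 * q%:R = p%:R).
  exact: rational_blocks E.
apply: irrational_blocks => // i z i0; apply/negP => /eqP E; apply: irr.
have iR : 0 < i%:R :> R by rewrite ltr0n.
have z0 : 0 <= z by rewrite -(ler_int R) -E; nra.
by exists `|z|%N, i; split => //; rewrite E pmulrn gez0_abs.
Qed.

(** * Growth of the number of paths *)

Definition walks (R : realType) (h : nat) (a x : R) (n i : nat) : nat :=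
  run h (mech a x n) (fun=> 1%N) i.

Lemma walks_cat (R : realType) h (a x : R) n m i :
  walks h a x (n + m) i = run h (mech a x n) (walks h a (x + a * n%:R) m) i.
Proof. by rewrite /walks mech_cat run_cat. Qed.

Lemma walks_gt0 (R : realType) h (a x : R) n i : (0 < walks h a x n i)%N.
Proof. exact: run1_gt0. Qed.

Lemma walks_le (R : realType) h (a x : R) n i : (walks h a x n i <= 2 ^ n)%N.
Proof. by rewrite -[in leqRHS](size_jumps (rotation a x) n) run1_le. Qed.

Lemma walks_trunc (R : realType) h (a x : R) n m i :
  (walks h a x (n + m) i <= 2 ^ m * walks h a x n i)%N.
Proof. by rewrite walks_cat; apply: run_scale => j; apply: walks_le. Qed.

Lemma dom_mech_iter (R : realType) (a a' : R) m M c k :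
  (forall x x', dom c (mech a x m) (mech a' x' (m + M))) ->
  forall x x', dom (c * k) (mech a x (m * k)) (mech a' x' ((m + M) * k)).
Proof.
move=> H; elim: k => [|k IH] x x'; first by rewrite !muln0; apply: dom_subseq.
by rewrite !mulnS mech_cat (mech_cat _ _ (m + M)); apply: dom_cat.
Qed.

(** The word is covered by [k.+1] blocks. Each block costs [c], and on the larger side the letters
    beyond [n] are cut off at a factor 2 each; [eps] is shared between the two. *)
Lemma walks_compare (R : realType) (a0 eps : R) : 0 < a0 < 1 -> 0 < eps ->
  exists2 delta : R, 0 < delta & exists C : nat,
    forall a a' : R, 0 < a < 1 -> 0 < a' < 1 ->
      `|a - a0| < delta -> `|a' - a0| < delta ->
      forall n, exists2 E : nat, E%:R <= eps * n%:R + C%:R &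
        forall h x x' i, (walks h a x n i <= 2 ^ E * walks h a' x' n i)%N.
Proof.
move=> a01 eps0; have e2 : 0 < eps / 2 by rewrite divr_gt0.
have [delta delta0 [m [M [c [m0 HM Hc H]]]]] := blocks a01 e2.
exists delta => //; exists (c + M + m)%N => a a' a1 a1' aa aa' n.
pose k := (n %/ m)%N; have nk := divn_eq n m; rewrite -/k in nk.
have nm : (n %% m < m)%N by rewrite ltn_mod.
have nk1 : (n <= m * k.+1)%N by move: nk nm; clear; nia.
pose E := (c * k.+1 + (m * k.+1 - n + M * k.+1))%N.
exists E.
  have E1 : (E <= c * k + M * k + (c + M + m))%N.
    by rewrite /E; move: nk nm; clear; nia.
  have : E%:R <= (c * k + M * k + (c + M + m))%:R :> R by rewrite ler_nat.
  move/le_trans; apply; rewrite natrD lerD2r natrD !natrM.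
  have k0 : 0 <= k%:R :> R by [].
  have kn : k%:R * m%:R <= n%:R :> R by rewrite -natrM ler_nat leq_trunc_div.
  have H1 := ler_wpM2r k0 HM; have H2 := ler_wpM2r k0 Hc.
  have H3 : eps * (k%:R * m%:R) <= eps * n%:R by rewrite ler_pM2l.
  by lra.
move=> h x x' i.
apply: (@leq_trans (walks h a x (m * k.+1) i)).
  by apply: run_subseq; apply: subseq_mech0.
have D := dom_mech_iter k.+1 (H a a' a1 a1' aa aa') x x' h (fun=> 1%N) i.
apply: leq_trans D _.
rewrite -/(walks h a' x' ((m + M) * k.+1) i) /E expnD -mulnA leq_mul2l; apply/orP; right.
have -> : ((m + M) * k.+1 = n + (m * k.+1 - n + M * k.+1))%N.
  by rewrite mulnDl addnA subnKC.
exact: walks_trunc.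
Qed.

Lemma run_nseq_down h n f i d : (d <= n)%N -> (d <= i)%N ->
  (f (i - d)%N <= run h (nseq n true) f i)%N.
Proof.
elim: n i d => [|n IH] i d; first by rewrite leqn0 => /eqP ->; rewrite subn0.
move=> dn di /=; rewrite /step; case: d dn di => [|d] dn di.
  by apply: leq_trans (IH i 0%N isT isT) (leq_addr _ _).
case: i di => [//|i] di; apply: leq_trans (leq_addl _ _).
by rewrite subSS; apply: IH.
Qed.

Lemma run_nseq_up h n f i d : (d <= n)%N -> (i + d < h)%N ->
  (f (i + d)%N <= run h (nseq n false) f i)%N.
Proof.
elim: n i d => [|n IH] i d; first by rewrite leqn0 => /eqP ->; rewrite addn0.
move=> dn di /=; rewrite /step; case: d dn di => [|d] dn di.
  by apply: leq_trans (IH i 0%N isT di) (leq_addr _ _).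
apply: leq_trans (leq_addl _ _); rewrite ifT; last by lia.
by rewrite addnS -addSn; apply: IH; lia.
Qed.

(** Once [a * l1 >= 1] and [(1 - a) * l2 >= 1], the height gained over [l1 + l2] letters is neither
    0 nor [l1 + l2]. *)
Lemma mech_both_letters (R : realType) (a : R) : 0 < a < 1 ->
  exists l, forall x b, b \in mech a x l.
Proof.
move=> a01; have a0 : 0 < a by case/andP: a01.
have b0 : 0 < 1 - a by lra.
have [l1 _ H1] := @exists_large_nat R a 1 a0.
have [l2 _ H2] := @exists_large_nat R (1 - a) 1 b0.
exists (l1 + l2)%N => x b.
have l10 : 0 <= l1%:R :> R by []. have l20 : 0 <= l2%:R :> R by [].
have := floor_itv (x + a * (l1 + l2)%:R); have := floor_itv x.
rewrite natrD !intrD => F1 F2.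
case: b;
  [apply: jumps_true | apply: jumps_false; first by move=> k; apply: rotation_step];
  rewrite /rotation mulr0 addr0 natrD => e.
- by rewrite e in F2; nra.
- by rewrite e intrD -pmulrn natrD in F2; nra.
Qed.

Lemma mech_contains_nseq (R : realType) (a : R) l n b :
  (forall x, b \in mech a x l) -> forall x, subseq (nseq n b) (mech a x (l * n)).
Proof.
move=> H; elim: n => [|n IH] x; first exact: sub0seq.
by rewrite mulnS mech_cat -[nseq _ _]/([:: b] ++ nseq n b) cat_subseq // sub1seq.
Qed.

(** Descend to level 0, then climb to [j], idling on the other letters. That [L] depends on [h] is
    harmless: the existence of the limit concerns one [r] at a time. *)
Lemma mech_connects_levels (R : realType) (a : R) h : 0 < a < 1 ->
  exists L, forall x f i j, (i < h)%N -> (j < h)%N ->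
    (f j <= run h (mech a x L) f i)%N.
Proof.
move=> a01; have [l Hl] := mech_both_letters a01.
exists (l * h + l * h)%N => x f i j ih jh; rewrite mech_cat run_cat.
set s := mech a x _; set t := mech _ _ _.
apply: (@leq_trans (run h (nseq h true) (run h t f) i)); last first.
  by apply: run_subseq; apply: mech_contains_nseq => y; apply: Hl.
apply: leq_trans (@run_nseq_down h h _ i i (ltnW ih) (leqnn i)).
rewrite subnn; apply: leq_trans (@run_nseq_up h h f 0 j (ltnW jh) _) _ => //.
by apply: run_subseq; apply: mech_contains_nseq => y; apply: Hl.
Qed.

(** The tail starts at another phase and at any level [j]. Level [i] is joined to [j] by [L]
    letters, [walks_compare] changes the phase, and the [L] added letters are cut off at a factor
    [2 ^ L]. *)
Lemma walks_submult (R : realType) h (a eps : R) i : 0 < a < 1 -> 0 < eps ->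
  (i < h)%N ->
  exists C : nat, forall n m, exists2 E : nat, E%:R <= eps * m%:R + C%:R &
    (walks h a 0%R (n + m) i <= 2 ^ E * walks h a 0%R m i * walks h a 0%R n i)%N.
Proof.
move=> a01 eps0 ih; have [delta delta0 [C HC]] := walks_compare a01 eps0.
have [L HL] := mech_connects_levels h a01.
exists (C + L)%N => n m.
have aa : `|a - a| < delta by rewrite subrr normr0.
have [E HE HW] := HC a a a01 a01 aa aa m.
exists (E + L)%N; first by rewrite !natrD addrA lerD2r.
rewrite walks_cat; apply: run_scale_lt => // j jh.
apply: leq_trans (HL 0%R (walks h a (0 + a * n%:R) m) i j ih jh) _.
apply: (@leq_trans (2 ^ E * walks h a 0%R (L + m) i)).
  by rewrite walks_cat; apply: run_mono => k; apply: HW.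
by rewrite expnD -mulnA leq_mul2l addnC walks_trunc orbT.
Qed.

(** A variant of Fekete's lemma: a large [m] absorbs [C], and dividing [n] by [m] with remainder
    bounds [u n / n] by [u m / m + eps] for large [n]. *)
Lemma quasi_subadditive_cvg (R : realType) (u : nat -> R) :
  (forall n, 0 <= u n <= n%:R) ->
  (forall eps, 0 < eps -> exists C : nat, forall n m,
    u (n + m)%N <= u n + u m + eps * m%:R + C%:R) ->
  cvgn (fun n => u n / n%:R).
Proof.
move=> u01 Hu; pose v n := u n / n%:R.
have v01 n : 0 <= v n <= 1.
  rewrite /v; case: n => [|n]; first by rewrite invr0 mulr0 lexx ler01.
  have n0 : 0 < n.+1%:R :> R by [].
  have /andP[h1 h2] := u01 n.+1.
  by rewrite ler_pdivrMr // mul1r divr_ge0 // ltW.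
have key eps : 0 < eps -> exists N, forall m, (N <= m)%N ->
    exists N', forall n, (N' <= n)%N -> v n <= v m + eps.
  move=> eps0; have e4 : 0 < eps / 4 by rewrite divr_gt0.
  have e2 : 0 < eps / 2 by rewrite divr_gt0.
  have [C HC] := Hu _ e4; have [N N0 HN] := @exists_large_nat R (eps / 4) C%:R e4.
  exists N => m Nm; have m0 : (0 < m)%N := leq_trans N0 Nm.
  have mR : 0 < m%:R :> R by rewrite ltr0n.
  have [N' N'0 HN'] := @exists_large_nat R (eps / 2) m%:R e2.
  exists N' => n N'n.
  have nR : 0 < n%:R :> R by rewrite ltr0n (leq_trans N'0).
  have it k s : u (k * m + s)%N <= u s + k%:R * (u m + eps / 4 * m%:R + C%:R).
    elim: k => [|k IH]; first by rewrite mul0n add0n mul0r addr0.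
    have := HC (k * m + s)%N m.
    rewrite (_ : k * m + s + m = k.+1 * m + s)%N; last by rewrite mulSn addnC addnA.
    by move/le_trans; apply; rewrite -[k.+1%:R]natr1; lra.
  rewrite {1}/v ler_pdivrMr //.
  have := it (n %/ m)%N (n %% m)%N; rewrite -divn_eq => /le_trans; apply.
  have Nm' : eps / 4 * N%:R <= eps / 4 * m%:R by rewrite ler_pM2l // ler_nat.
  have Nn' : eps / 2 * N'%:R <= eps / 2 * n%:R by rewrite ler_pM2l // ler_nat.
  have um : u m = v m * m%:R by rewrite /v divfK // gt_eqF.
  have us : u (n %% m)%N <= m%:R.
    case/andP: (u01 (n %% m)%N) => _ /le_trans; apply.
    by rewrite ler_nat ltnW // ltn_mod.
  have kR : 0 <= (n %/ m)%:R :> R by [].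
  have kn : (n %/ m)%:R * m%:R <= n%:R :> R by rewrite -natrM ler_nat leq_trunc_div.
  have vm0 : 0 <= v m + eps / 2 by case/andP: (v01 m) => vm _; rewrite addr_ge0 // ltW.
  have P1 := ler_wpM2l vm0 kn.
  have P2 : (n %/ m)%:R * (u m + eps / 4 * m%:R + C%:R) <=
     (n %/ m)%:R * ((v m + eps / 2) * m%:R).
    by apply: ler_wpM2l => //; rewrite um; clear -HN Nm'; lra.
  by clear -P1 P2 us HN' Nn'; lra.
(* [sup S] is the lower limit of [v], hence the only candidate for the limit. *)
pose S := [set t : R | exists N, forall n, (N <= n)%N -> t <= v n].
have S0 : S 0 by exists 0%N => n _; case/andP: (v01 n).
have S1 : ubound S 1.
  by move=> t [N HN]; apply: le_trans (HN N (leqnn N)) _; case/andP: (v01 N).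
have supS : has_sup S by split; [exists 0 | exists 1].
apply/cvg_ex; exists (sup S); apply/cvgrPdist_le => eps eps0.
have e2 : 0 < eps / 2 by rewrite divr_gt0.
have [t [N1 HN1] tS] := sup_adherent e2 supS.
have [N2 HN2] := key _ e2.
have [m N2m vm] : exists2 m, (N2 <= m)%N & v m < sup S + eps / 2.
  apply: contrapT => H.
  have : S (sup S + eps / 2).
    exists N2 => n N2n; rewrite leNgt; apply/negP => vn; apply: H.
    by exists n.
  by move/(sup_upper_bound supS); clear -e2; lra.
have [N3 HN3] := HN2 m N2m.
near=> n.
have n1 : (N1 <= n)%N by near: n; apply: nbhs_infty_ge.
have n3 : (N3 <= n)%N by near: n; apply: nbhs_infty_ge.
have h1 := HN1 n n1; have h3 := HN3 n n3; rewrite -/(v n) ler_norml.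
by clear -h1 h3 vm tS; apply/andP; split; lra.
Unshelve. all: by end_near.
Qed.

(** * Balanced words as paths *)

Lemma card_tuple_cons (P : pred (seq bool)) n :
  #|[set w : n.+1.-tuple bool | P w]%SET| =
  (#|[set w : n.-tuple bool | P (false :: w)]%SET| +
   #|[set w : n.-tuple bool | P (true :: w)]%SET|)%N.
Proof.
pose f (b : bool) (w : n.-tuple bool) := [tuple of b :: w].
have finj b : injective (f b) by move=> w w' /(congr1 val) [] /val_inj.
rewrite -(card_imset _ (finj false)) -(card_imset _ (finj true)).
set A := _ @: _; set B := _ @: _.
have -> : [set w : n.+1.-tuple bool | P w]%SET = (A :|: B)%SET.
  apply/setP => w; rewrite !inE; case: (tupleP w) => b t.
  apply/idP/orP => [Pw | [] /imsetP [t' + ->]]; last 2 first.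
  - by rewrite inE.
  - by rewrite inE.
  by case: b Pw => Pw; [right|left]; apply/imsetP; exists t;
    rewrite ?inE //; apply: val_inj.
rewrite cardsU (_ : A :&: B = finset.set0)%SET ?finset.cards0 ?subn0 //.
apply/setP => w; rewrite !inE; apply/negP => /andP[/imsetP [t _ ->] /imsetP [t' _]].
by move/(congr1 val).
Qed.

(** The balance condition from a later time on, with phase [x] and [c] zeros already read: a form
    stable under removing the first letter. *)
Definition stays (R : realType) (a : R) (r : nat) (x : R) (c : int)
    (w : seq bool) : bool :=
  all (fun k => (x + a * k%:R - r%:R < c%:~R + (num0 (take k w))%:R) &&
     (c%:~R + (num0 (take k w))%:R <= x + a * k%:R + r%:R)) (iota 0 (size w).+1).

Lemma stays_cons (R : realType) (a : R) r x c b w :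
  stays a r x c (b :: w) =
  (x - r%:R < c%:~R <= x + r%:R) && stays a r (x + a) (c + (~~ b)%:Z) w.
Proof.
rewrite /stays -[(size (b :: w)).+1]/(1 + (size w).+1)%N iotaD all_cat.
rewrite addnC iotaDl all_map; congr andb.
  by rewrite [iota 0 1]/= all_seq1 take0 mulr0 !addr0.
apply: eq_all => k; rewrite /preim /= add1n /= /num0 /= natrD -natr1 intrD eqbF_neg.
rewrite mulrDr mulr1 [a * _ + a]addrC !addrA.
by rewrite add0n.
Qed.

(** The half-open window holds exactly [2 * r] integers and depends on [x] only through its floor;
    the middle term on the right is the level. *)
Lemma level_range (R : realType) (r : nat) (x : R) (c : int) :
  (x - r%:R < c%:~R <= x + r%:R) =
  (0 <= c + r%:Z - 1 - Num.floor x < (r + r)%N%:Z).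
Proof.
have -> : (x - r%:R < c%:~R) = (Num.floor x < c + r%:Z).
  by rewrite floor_lt_int intrD -pmulrn ltrBlDr.
have -> : (c%:~R <= x + r%:R) = (c - r%:Z <= Num.floor x).
  by rewrite floor_ge_int intrB -pmulrn lerBlDr.
by set y := Num.floor x; clearbody y; lia.
Qed.

Lemma card_stays (R : realType) (a : R) r n x (c : int) : 0 < a < 1 ->
  #|[set w : n.-tuple bool | stays a r x c w]%SET| =
  if 0 <= c + r%:Z - 1 - Num.floor x < (r + r)%N%:Z then
    run (r + r) (mech a x n) (fun=> 1%N) (absz (c + r%:Z - 1 - Num.floor x)%R)
  else 0%N.
Proof.
move=> a01; elim: n x c => [|n IH] x c.
  have st (w : 0.-tuple bool) : stays a r x c w = (x - r%:R < c%:~R <= x + r%:R).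
    by rewrite (tuple0 w) /stays /= mulr0 !addr0 andbT.
  have -> : [set w : 0.-tuple bool | stays a r x c w]%SET =
      if x - r%:R < c%:~R <= x + r%:R then [set: 0.-tuple bool]%SET else finset.set0.
    by apply/setP => w; rewrite inE st; case: ifP; rewrite inE.
  by rewrite level_range; case: ifP; rewrite ?finset.cards0 // finset.cardsT card_tuple.
have split_head b : [set w : n.-tuple bool | stays a r x c (b :: w)]%SET =
    if x - r%:R < c%:~R <= x + r%:R
    then [set w : n.-tuple bool | stays a r (x + a) (c + (~~ b)%:Z) w]%SET
    else finset.set0.
  by apply/setP => w; rewrite inE stays_cons; case: ifP; rewrite inE.
rewrite card_tuple_cons !split_head level_range.
case: ifP => [ok|_]; last by rewrite !finset.cards0.
rewrite !IH /mech jumpsS /= addr0 /rotation mulr0 mulr1 addr0.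
have -> : jumps (fun k => Num.floor (x + a * k.+1%:R)) n = mech a (x + a) n.
  by apply: eq_jumps => k _; rewrite /rotation -natr1; congr Num.floor; ring.
rewrite -/(mech a (x + a) n); set g := run _ (mech _ _ _) _.
have := rotation_step x 0 a01; rewrite /rotation mulr0 addr0 mulr1.
move: ok; set y := Num.floor x; set y' := Num.floor (x + a).
clearbody y y' g => ok yy.
pose i := absz (c + r%:Z - 1 - y)%R.
have Ei : c = i%:Z - r%:Z + 1 + y by rewrite /i; move: ok; clear; lia.
have ir : (i < r + r)%N by rewrite /i; move: ok; clear; lia.
rewrite -/i; clearbody i; rewrite Ei {ok}.
(* Without a jump the letter 0 raises the level and 1 keeps it; a jump moves the reference up by
   one, so 0 keeps the level and 1 lowers it. *)
have [E|E] : y' = y \/ y' = y + 1 by move: yy; clear; lia.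
- rewrite E eqxx /step /=.
  rewrite (_ : _ + 1 + r%:Z - 1 - y = i.+1%:Z); last by lia.
  rewrite (_ : _ + y + r%:Z - 1 - y = i%:Z); last by lia.
  by rewrite !ltz_nat ir !lez_nat /= addnC.
- rewrite E (_ : y + 1 != y) /step /=; last by lia.
  rewrite (_ : _ + 1 + r%:Z - 1 - (y + 1) = i%:Z); last by lia.
  rewrite (_ : _ + y + r%:Z - 1 - (y + 1) = i%:Z - 1); last by lia.
  rewrite ltz_nat ir /=; congr (_ + _)%N.
  (* From level 0 the letter 1 would lead to level -1, which fails the range test and matches the
     value 0 in [step]. *)
  case: i ir {Ei} => [|i] ir //.
  rewrite (_ : i.+1%:Z - 1 = i%:Z); last by lia.
  by rewrite ltz_nat (ltnW ir).
Qed.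

Lemma card_balanced_words (R : realType) (a : R) r n : 0 < a < 1 -> (0 < r)%N ->
  #|balanced_words n a r| = run (r + r) (mech a 0 n) (fun=> 1%N) r.-1.
Proof.
move=> a01 r0; have := @card_stays R a r n 0 0 a01.
rewrite floor0 subr0 add0r (_ : r%:Z - 1 = r.-1%:Z); last by lia.
rewrite ifT; last by lia.
move=> <-; congr #|pred_of_set _|; apply/setP => w; rewrite !inE /stays size_tuple.
apply/forallP/allP => [H k|H k].
  rewrite mem_iota add0n => /andP[_ kn].
  by have := H (Ordinal kn); rewrite /= !add0r.
by have := H k; rewrite mem_iota add0n ltn_ord !add0r; apply.
Qed.

(** * Limits and uniform continuity *)

Definition log_walks (R : realType) (a : R) (r n : nat) : R :=
  ln (walks (r + r) a 0%R n r.-1)%:R.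

Lemma ln_pow2_le (R : realType) n : ln (2 ^ n)%:R <= n%:R :> R.
Proof.
rewrite natrX lnXn // -[leRHS]mulr1 -[_ *+ n]mulr_natl ler_wpM2l //.
by have := @le_ln1Dx R 1; rewrite (_ : 1 + 1 = 2) //; apply; lra.
Qed.

Lemma ln_nat_mul (R : realType) (m n : nat) : (0 < m)%N -> (0 < n)%N ->
  ln (m * n)%:R = ln m%:R + ln n%:R :> R.
Proof. by move=> m0 n0; rewrite natrM lnM // posrE ltr0n. Qed.

Lemma ln_nat_le (R : realType) (m n : nat) : (0 < m)%N -> (m <= n)%N ->
  ln m%:R <= ln n%:R :> R.
Proof.
move=> m0 mn; rewrite ler_ln ?posrE ?ltr0n ?ler_nat //.
exact: leq_trans mn.
Qed.

Lemma log_walks_bounds (R : realType) (a : R) r n : 0 <= log_walks a r n <= n%:R.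
Proof.
apply/andP; split; first by rewrite ln_ge0 // ler1n walks_gt0.
apply: le_trans (ln_pow2_le R n).
by apply: ln_nat_le; [apply: walks_gt0 | apply: walks_le].
Qed.

Lemma cvg_log_walks (R : realType) (a : R) r : 0 < a < 1 -> (0 < r)%N ->
  cvgn (fun n => log_walks a r n / n%:R).
Proof.
move=> a01 r0; apply: quasi_subadditive_cvg; first exact: log_walks_bounds.
move=> eps eps0.
have ir : (r.-1 < r + r)%N by rewrite -ltnS prednK // ltnS leq_addl.
have [C HC] := walks_submult a01 eps0 ir.
exists C => n m; have [E HE HW] := HC n m.
have P := ln_nat_le R (walks_gt0 _ _ _ _ _) HW.
rewrite !ln_nat_mul ?muln_gt0 ?expn_gt0 ?walks_gt0 // in P.
have := ln_pow2_le R E; move: P HE; rewrite -!/(log_walks _ _ _).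
by clear; lra.
Qed.

Lemma root_card_balancedE (R : realType) (a : R) r : 0 < a < 1 -> (0 < r)%N ->
  root_card_balanced a r = (fun n => expR (log_walks a r n / n%:R)).
Proof.
move=> a01 r0; apply/funext => n.
rewrite /root_card_balanced card_balanced_words // -/(walks (r + r) a 0 n r.-1).
by rewrite /powR pnatr_eq0 gtn_eqF ?walks_gt0 // mulrC.
Qed.

Lemma cvg_root_card_balanced (R : realType) (a : R) r : 0 < a < 1 -> (0 < r)%N ->
  root_card_balanced a r @ \oo -->
    expR (limn (fun n => log_walks a r n / n%:R)).
Proof.
move=> a01 r0; rewrite root_card_balancedE //.
apply: (@continuous_cvg _ _ _ _ _ _ expR); first exact: continuous_expR.
exact: cvg_log_walks.
Qed.

(** Each quotient is within [eps] of its limit, and [C <= eps * n] for large [n] makes the linear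
    error [2 * eps]; hence the 4. *)
Lemma lim_le_linear_error (R : realType) (u v : nat -> R) (eps : R) (C : nat) :
  0 < eps -> cvgn (fun n => u n / n%:R) -> cvgn (fun n => v n / n%:R) ->
  (forall n, u n <= v n + (eps * n%:R + C%:R)) ->
  limn (fun n => u n / n%:R) <= limn (fun n => v n / n%:R) + 4 * eps.
Proof.
move=> eps0 cu cv uv.
set l := limn _; set l' := limn _.
have [N N0 HN] := @exists_large_nat R eps C%:R eps0.
near \oo => n.
have Nn : (N <= n)%N by near: n; apply: nbhs_infty_ge.
have n0 : 0 < n%:R :> R by rewrite ltr0n (leq_trans N0).
have H1 : `|l - u n / n%:R| <= eps.
  by near: n; move/cvgrPdist_le: cu; apply.
have H2 : `|l' - v n / n%:R| <= eps.
  by near: n; move/cvgrPdist_le: cv; apply.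
have H3 : u n / n%:R <= v n / n%:R + 2 * eps.
  rewrite ler_pdivrMr // mulrDl divfK ?gt_eqF //.
  have Nn' : eps * N%:R <= eps * n%:R by rewrite ler_pM2l // ler_nat.
  by have := uv n; move: HN Nn'; clear; lra.
move: H1 H2 H3; rewrite !ler_norml; clear.
by move=> /andP[? ?] /andP[? ?] ?; lra.
Unshelve. all: by end_near.
Qed.

(** With [4 * d = ln t], the hypothesis gives [expR x <= expR y * t], and [t] is chosen so that
    [expR B * (t - 1)] is [eps / 2]. *)
Lemma expR_uniform (R : realType) (B eps : R) : 0 < eps ->
  exists2 d : R, 0 < d & forall x y, y <= B -> x <= y + 4 * d ->
    expR x - expR y < eps.
Proof.
move=> eps0; have B0 := expR_gt0 B.
pose t := 1 + eps / (2 * expR B).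
have t0 : 0 < eps / (2 * expR B) by rewrite divr_gt0 // mulr_gt0.
exists (ln t / 4); first by rewrite divr_gt0 // ln_gt0 // ltrDl.
move=> x y yB; rewrite mulrC divfK // => xy.
have tp : t \is Num.pos by rewrite posrE addr_gt0.
have : expR x <= expR y * t by rewrite -[X in _ * X](lnK tp) -expRD ler_expR.
have y0 := expR_gt0 y; have yB' : expR y <= expR B by rewrite ler_expR.
have : expR y * (eps / (2 * expR B)) <= expR B * (eps / (2 * expR B)).
  by rewrite ler_wpM2r // ltW.
have -> : expR B * (eps / (2 * expR B)) = eps / 2 by field; rewrite gt_eqF.
by rewrite /t mulrDr mulr1; lra.
Qed.

Theorem mainTheorem1 (R : realType) :
  (forall (alpha : R) (r : nat), 0 < alpha < 1 -> (1 <= r)%N ->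
     cvgn (root_card_balanced alpha r)) /\
  (forall alpha : R, 0 < alpha < 1 -> forall eps : R, 0 < eps ->
     exists2 delta : R, 0 < delta &
       forall alpha' : R, 0 < alpha' < 1 -> `|alpha' - alpha| < delta ->
         forall r : nat, (1 <= r)%N ->
           `|growth_rate alpha' r - growth_rate alpha r| < eps).
Proof.
split=> [a r a01 r0|a a01 eps eps0].
  by apply/cvg_ex; eexists; apply: cvg_root_card_balanced.
have [d d0 Hd] := expR_uniform 1 eps0.
have [delta delta0 [C HC]] := walks_compare a01 d0.
exists delta => // a' a01' aa' r r0.
have aa : `|a - a| < delta by rewrite subrr normr0.
(* The bound 1 does not depend on [r], so the single [d] obtained above serves all [r]. *)
have lim_le1 b : 0 < b < 1 -> limn (fun n => log_walks b r n / n%:R) <= 1.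
  move=> b01; apply: limr_le; first exact: cvg_log_walks.
  apply: nearW => -[|n]; first by rewrite invr0 mulr0.
  by rewrite ler_pdivrMr // mul1r; case/andP: (log_walks_bounds b r n.+1).
have close b b' : 0 < b < 1 -> 0 < b' < 1 -> `|b - a| < delta -> `|b' - a| < delta ->
    growth_rate b r - growth_rate b' r < eps.
  move=> b01 b01' ba ba'; rewrite /growth_rate.
  have /cvg_lim -> // := cvg_root_card_balanced b01 r0.
  have /cvg_lim -> // := cvg_root_card_balanced b01' r0.
  apply: Hd; first exact: lim_le1.
  apply: (@lim_le_linear_error _ _ _ _ C) => //; try exact: cvg_log_walks.
  move=> n; have [E HE HW] := HC b b' b01 b01' ba ba' n.
  have P := ln_nat_le R (walks_gt0 _ _ _ _ _) (HW (r + r)%N 0%R 0%R r.-1).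
  rewrite ln_nat_mul ?expn_gt0 ?walks_gt0 // in P.
  have := ln_pow2_le R E; move: P HE; rewrite -!/(log_walks _ _ _).
  by clear; lra.
by rewrite ltr_norml ltrNl opprB !close.
Qed.
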